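(* Let $\beta\in\mathbb{R}_{++}$ and $r\in\{2,4,6,8,\ldots\}$. Let $f:\mathbb{R}\to\left]-\infty,+\infty\right]$ be given by $f(x)=\exp(-\beta x^{-r})$ for $x\neq0$ in $\big[-(\beta r/(r+1))^{1/r},(\beta r/(r+1))^{1/r}\big]$, $f(0)=0$, and $f(x)=+\infty$ outside this interval. Let $L:=\mathbb{R}\times\{0\}$ and $C:=\operatorname{epi} f$ in $\mathbb{R}^2$. Let $\delta\in\mathbb{R}_{++}$ be such that $f$ is differentiable on $[0,\delta]$, let $u_0\in\left]0,\delta\right[$, set $x^{(0)}:=(u_0,0)$, and generate the sequence of alternating projections by $$x^{(2n+1)}:=P_Cx^{(2n)}\quad\text{and}\quad x^{(2n+2)}:=P_Lx^{(2n+1)}\qquad(n\in\mathbb{N}).$$ Write $x^{(2n)}=(u_n,0)$ for $n\in\mathbb{N}$. Then $$\lim_{n\to\infty}\frac{u_n}{\left(\frac{2\beta}{\ln(n)}\right)^{1/r}}=1,$$ and $$\sum_{n=0}^\infty\|x^{(n+1)}-x^{(n)}\|^\gamma=+\infty\quad\text{for all }\gamma\in\left]0,2\right[.$$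
   Context: $\mathbb{R}_{++}=\left]0,+\infty\right[$, $\mathbb{N}=\{0,1,2,\ldots\}$. $\mathbb{R}^2$ carries the Euclidean norm. $\operatorname{epi} f=\{(x,y)\in\mathbb{R}\times\mathbb{R}\mid f(x)\le y\}$ is the epigraph of $f$. For a nonempty closed convex set $S$, $P_S$ is the metric (nearest-point) projector onto $S$. *)

(* Defs.v *)
From HB Require Import structures.
From mathcomp Require Import all_boot all_order all_algebra.
From mathcomp Require Import all_classical all_reals all_analysis.
Set Implicit Arguments.
Unset Strict Implicit.
Unset Printing Implicit Defensive.
Import Order.TTheory GRing.Theory Num.Theory.
Import numFieldNormedType.Exports.
Local Open Scope classical_set_scope.
Local Open Scope ring_scope.

(* The library norm on R * R is the max norm, hence a separate Euclidean norm *)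
Definition enorm (R : realType) (p : R * R) : R :=
  Num.sqrt (p.1 ^+ 2 + p.2 ^+ 2).

(* A point of S nearest to p, which exists and is unique when S is nonempty,
   closed and convex; if there is none, metric_proj S p is the dummy p. *)
Definition metric_proj (R : realType) (S : set (R * R)) (p : R * R) : R * R :=
  xget p [set q | S q /\ forall s, S s -> enorm (p - q) <= enorm (p - s)].

Definition epigraph (R : realType) (f : R -> \bar R) : set (R * R) :=
  [set p | (f p.1 <= p.2%:E)%E].

(* Differentiability of an extended-real-valued function, as in convex
   analysis: x has to be interior to the set where f is finite. *)
Definition ediff (R : realType) (f : R -> \bar R) (x : R) : Prop :=
  (\forall z \near x, f z \is a fin_num) /\ derivable (fine \o f) x 1.

Definition flat_bound (R : realType) (beta : R) (r : nat) : R :=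
  (beta * r%:R / r.+1%:R) `^ (r%:R^-1).

Definition flat_exp (R : realType) (beta : R) (r : nat) (x : R) : \bar R :=
  if x == 0 then 0%E
  else if - flat_bound beta r <= x <= flat_bound beta r
       then (expR (- beta * x ^- r))%:E
       else +oo%E.

Definition xaxis (R : realType) : set (R * R) := [set p | p.2 = 0].

(* Main.v *)
Require Import Defs.
From HB Require Import structures.
From mathcomp Require Import all_boot all_order all_algebra.
From mathcomp Require Import all_classical all_reals all_analysis.
From mathcomp Require Import ring lra zify.
Import Order.TTheory GRing.Theory Num.Theory.
Import numFieldNormedType.Exports.
Local Open Scope classical_set_scope.
Local Open Scope ring_scope.

(** Any nearest point (a, f a) of epi f to (v, 0) minimizes (t - v)^2 + f(t)^2,
    so v - a = f(a) f'(a) = beta r a^-(r+1) exp(- w(a)) with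
    w(a) := 2 beta a^-r; no convexity of f is needed for this.  Bernoulli's
    inequality then bounds the increments of w_n := 2 beta u_n^-r by
      c <= (w_(n+1) - w_n) exp(w_(n+1)) <= K w_(n+1)^4 ,
    whence k n <= exp(w_n), and exp(t w_n) = O(n) for every t in ]0,1[.
    These give w_n ~ ln n, which is the first claim.  For the second one,
    |x_(2n+1) - x_(2n)|^gamma >= f(u_(n+1))^gamma
                               = exp(- (gamma / 2) w_(n+1)) ,
    and t = gamma / 2 yields a harmonic minorant. *)

(** * Fermat's rule and the projection onto the axis *)

Lemma derive_local_min (R : realFieldType) (f : R -> R) (c : R) :
  derivable f c 1 -> (\forall z \near c, f c <= f z) -> 'D_1 f c = 0.
Proof.
move=> df cmin.
have {}cmin : \forall h \near (0 : R), f c <= f (h *: 1 + c).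
  have /(_ _ cmin) : (fun h : R => h *: 1 + c) @ (0 : R) --> c.
    rewrite -[X in _ --> X]add0r -[X in _ --> X + c](scale0r (1 : R)).
    by apply: cvgD; [exact: cvgZr_tmp | exact: cvg_cst].
  by [].
apply/eqP; rewrite eq_le; apply/andP; split.
(* At a local minimum the difference quotients are nonpositive for [h < 0] and nonnegative for
   [h > 0]; both one-sided limits equal the derivative. *)
- rewrite ['D_1 f c]cvg_at_leftE//; apply: limr_le.
    rewrite -(cvg_at_leftE (fun h : R => h^-1 *: ((f \o shift c) _ - f c))) //.
    apply: cvg_trans df; apply: cvg_app.
    move=> A [e egt0 Ae]; exists e => // x xe xgt0; apply: Ae => //.
    exact/ltr0_neq0.
  near=> h; apply: mulr_le0_ge0.
    by rewrite invr_le0; apply: ltW; near: h; exists 1 => /=.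
  rewrite subr_ge0 /=; near: h.
  by apply: cvg_within; exact: cmin.
- rewrite ['D_1 f c]cvg_at_rightE//; apply: limr_ge.
    rewrite -(cvg_at_rightE (fun h : R => h^-1 *: ((f \o shift c) _ - f c))) //.
    apply: cvg_trans df; apply: cvg_app.
    move=> A [e egt0 Ae]; exists e => // x xe xgt0; apply: Ae => //.
    exact/lt0r_neq0.
  near=> h; apply: mulr_ge0.
    by rewrite invr_ge0; apply: ltW; near: h; exists 1 => /=.
  rewrite subr_ge0 /=; near: h.
  by apply: cvg_within; exact: cmin.
Unshelve. all: by end_near. Qed.

Lemma enorm_le (R : realType) (p q : R * R) :
  (enorm p <= enorm q) = (p.1 ^+ 2 + p.2 ^+ 2 <= q.1 ^+ 2 + q.2 ^+ 2).
Proof. by rewrite ler_sqrt// addr_ge0// sqr_ge0. Qed.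

Lemma metric_proj_xaxis (R : realType) (p : R * R) :
  metric_proj (@xaxis R) p = (p.1, 0).
Proof.
apply: xget_unique => [|[a b] [/= b0 /(_ (p.1, 0) erefl)]].
  split=> // -[a b] /= b0; rewrite /xaxis /= in b0.
  by rewrite enorm_le /= b0 subrr expr0n add0r lerDr sqr_ge0.
rewrite /xaxis /= in b0; rewrite b0 enorm_le /= subrr expr0n add0r gerDr.
rewrite le_eqVlt ltNge sqr_ge0 orbF sqrf_eq0 subr_eq0 => /eqP.
by move=> ->.
Qed.

(** * Projection of a point of the axis onto the epigraph of an even function *)

Section nearest_point_of_epigraph.
Variables (R : realType) (f : R -> \bar R) (delta u : R).
Hypothesis f0 : f 0 = 0%E.
Hypothesis fN : forall x, f (- x) = f x.
Hypothesis f_nd : forall x y, 0 <= x -> x <= y -> (f x <= f y)%E.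
Hypothesis df : forall t, 0 <= t <= delta -> ediff f t.
Hypothesis u_itv : 0 < u < delta.

Let f_norm x : f `|x| = f x.
Proof. by case: ger0P. Qed.

Let f_ge0 x : (0 <= f x)%E.
Proof. by rewrite -f_norm -f0 f_nd. Qed.

Let F := fine \o f.
Let G t := (t - u) ^+ 2 + F t ^+ 2.

Let f_fin t : 0 <= t <= u -> f t = (F t)%:E.
Proof.
move=> /andP[t0 tu]; rewrite fineK//.
have [|/nbhs_singleton //] := df t.
by case/andP: u_itv => _ ud; rewrite t0 (le_trans tu)// ltW.
Qed.

Let F_ge0 t : 0 <= F t.
Proof. exact: fine_ge0. Qed.

Let F_le t y : 0 <= t <= u -> (f t <= y%:E)%E -> F t <= y.
Proof. by move=> /f_fin ->. Qed.

Let dF t : 0 <= t <= u -> derivable F t 1.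
Proof.
move=> /andP[t0 tu]; case/andP: u_itv => _ ud.
by have [|//] := df t; rewrite t0 (le_trans tu)// ltW.
Qed.

Let is_derive_G t : 0 <= t <= u ->
  is_derive t 1 G (2 * (t - u) + 2 * (F t * 'D_1 F t)).
Proof.
move=> /dF/derivableP dFt; rewrite /G.
apply: is_derive_eq.
by rewrite /GRing.scale /=; ring.
Qed.

(** [metric_proj] returns a nearest point only if one exists, so compactness of [[0, u]] first
    supplies one. Symmetry and monotonicity of [f] then confine any nearest point to the graph over
    [[0, u]], and the equation is [G' = 0] there. *)
Lemma metric_proj_epigraph : exists a : R,
  [/\ 0 < a <= u, u - a = F a * 'D_1 F a &
      metric_proj (epigraph f) (u, 0) = (a, F a)].
Proof.
have [u0 ud] := andP u_itv.
have [c cu Gc] : exists2 c, 0 <= c <= u & forall t, 0 <= t <= u -> G c <= G t.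
  have [c|c] := @EVT_min R G 0 u (ltW u0).
    apply: derivable_within_continuous => t; rewrite in_itv /= => tu.
    by have := is_derive_G _ tu => /@ex_derive.
  by rewrite in_itv /= => cu Gc; exists c.
have [q_epi q_min] : [set q | epigraph f q /\ forall s, epigraph f s ->
    enorm ((u, 0) - q) <= enorm ((u, 0) - s)] (metric_proj (epigraph f) (u, 0)).
  apply: (@xgetI _ _ _ (c, F c)); split; first by rewrite /epigraph /= f_fin.
  case=> s1 s2; rewrite /epigraph /= => fs; rewrite enorm_le /= !sub0r !sqrrN.
  have s20 : 0 <= s2 by rewrite -lee_fin (le_trans _ fs).
  (* Clamping [|s1|] to [[0, u]] increases neither the value of [f] nor the distance to [u], so the
     minimum of [G] on [[0, u]] competes with the whole epigraph. *)
  have tu : 0 <= Num.min `|s1| u <= u.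
    by rewrite le_min normr_ge0 ltW//= ge_min lexx orbT.
  have : F (Num.min `|s1| u) <= s2.
    apply: F_le => //; rewrite (le_trans _ fs)// -[leRHS]f_norm.
    by apply: f_nd; [case/andP: tu | rewrite ge_min lexx].
  have := Gc _ tu; rewrite /G -[(u - c) ^+ 2]sqrrN opprB => /le_trans + Fs.
  apply; apply: lerD; last by rewrite ler_sqr ?nnegrE.
  rewrite -[leRHS]sqrrN opprB -!(real_normK (num_real (_ - u))).
  rewrite ler_sqr ?nnegrE//.
  rewrite /Num.min; case: ltP => su; last by rewrite subrr normr0.
  by rewrite -{1}(gtr0_norm u0) ler_dist_dist.
case: (metric_proj _ _) q_epi q_min => a b; rewrite /epigraph /= => fab qmin.
have {}qmin s1 s2 : (f s1 <= s2%:E)%E ->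
    (a - u) ^+ 2 + b ^+ 2 <= (s1 - u) ^+ 2 + s2 ^+ 2.
  move=> /(qmin (s1, s2)).
  by rewrite enorm_le /= !sub0r -(opprB a) -(opprB s1) !sqrrN.
have b0 : 0 <= b by rewrite -lee_fin (le_trans _ fab).
(* If [a < 0], the reflected point [(- a, b)] is strictly closer. The comparison points below are
   [(u, b)] for [a <= u] and [(a, F a)] for [b = F a]. *)
have a0 : 0 <= a.
  rewrite leNgt; apply/negP => a0.
  have /qmin : (f (- a) <= b%:E)%E by rewrite fN.
  by rewrite lerD2r; nra.
have au : a <= u.
  rewrite leNgt; apply/negP => ua.
  have /qmin : (f u <= b%:E)%E by rewrite (le_trans _ fab)// f_nd// ltW.
  by rewrite lerD2r; nra.
have aitv : 0 <= a <= u by rewrite a0.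
have bE : b = F a.
  apply/eqP; rewrite eq_le (F_le _ _ _ fab)// andbT.
  have /qmin : (f a <= (F a)%:E)%E by rewrite f_fin.
  by rewrite lerD2l ler_sqr ?nnegrE.
have G'a : 2 * (a - u) + 2 * (F a * 'D_1 F a) = 0.
  have dGa := is_derive_G _ aitv; rewrite -(derive_val (is_derive := dGa)).
  (* The points [(z, F z)] with [z] in a full neighbourhood of [a] lie in the epigraph, so the
     minimum is two-sided even if [a] is an endpoint of [[0, u]]. *)
  apply: derive_local_min; first exact: ex_derive.
  have [|fin_a _] := df a; first by rewrite a0 (le_trans au)// ltW.
  near=> z.
  rewrite /G -bE; apply: qmin.
  by rewrite fineK//; near: z.
exists a; split; [|lra|by rewrite bE].
(* At [a = 0] the derivative of [G] would be [- 2 u], because [F 0 = 0]. *)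
rewrite au andbT lt_neqAle a0 andbT; apply/negP => /eqP a_0.
by move: G'a; rewrite -a_0 /F /= f0 /= => ?; lra.
Unshelve. all: by end_near. Qed.

End nearest_point_of_epigraph.

(** * Bernoulli's inequality and sequences of logarithmic growth *)

Lemma bernoulli_ineq (R : realDomainType) (n : nat) (y : R) :
  -1 <= y -> 1 + n%:R * y <= (1 + y) ^+ n.
Proof.
move=> y1; elim: n => [|n IHn]; first by rewrite mul0r addr0 expr0.
have y1' : 0 <= 1 + y by lra.
rewrite exprS; apply: le_trans (ler_wpM2l y1' IHn).
by rewrite -natr1; have := ler0n R n; nra.
Qed.

Section logarithmic_growth.
Variables (R : realType) (w : nat -> R).
Hypothesis w_ge0 : forall n, 0 <= w n.

(** Each step increases [expR (w n)] by at least [k]. Let [d] be the increment of [w], and [e], [E]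
    the old and new exponentials, so that [E >= (1 + d) e]. If [d > 1], then [E - e >= e >= 1]; if
    [d <= 1], then [c <= d E <= (1 + d) (E - e) <= 2 (E - e)]. *)
Lemma expR_growth_lower (c : R) : 0 < c ->
  (forall n, c <= (w n.+1 - w n) * expR (w n.+1)) ->
  exists2 k, 0 < k & forall n, k * n%:R <= expR (w n).
Proof.
move=> c0 wc; pose k := Num.min c 1 / 2.
have k0 : 0 < k by rewrite divr_gt0// lt_min c0 ltr01.
have kc : k * 2 <= c by rewrite /k divfK// ge_min lexx.
have k1 : k * 2 <= 1 by rewrite /k divfK// ge_min lexx orbT.
exists k => //; elim=> [|n IHn]; first by rewrite mulr0 expR_ge0.
rewrite -natr1 mulrDr mulr1.
have e1 : 1 <= expR (w n) by rewrite -expR0 ler_expR.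
have := wc n; set d := w n.+1 - w n => dE.
have d0 : 0 < d.
  by rewrite -(pmulr_lgt0 _ (expR_gt0 (w n.+1))) (lt_le_trans c0).
have : (1 + d) * expR (w n) <= expR (w n.+1).
  rewrite -[w n.+1](subrK (w n)) expRD ler_wpM2r ?expR_ge0//.
  exact: expR_ge1Dx.
move: dE IHn; set E := expR (w n.+1); set e := expR (w n) in e1 *.
move=> dE IHn eE; have [d1|d1] := leP d 1; last by nra.
suff : k <= E - e by lra.
have : c <= (1 + d) * (E - e) by nra.
nra.
Qed.

(** An increment [d >= 0] of [w] raises [expR (t w)] by at most [d expR (t w')], where [w'] is the
    new value. By hypothesis this is at most [K w'^4 expR (- (1 - t) w')], which is bounded;
    summation gives linear growth. *)
Lemma expR_growth_upper (K t : R) : 0 < t < 1 ->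
  (forall n, (w n.+1 - w n) * expR (w n.+1) <= K * w n.+1 ^+ 4) ->
  exists2 C, 0 < C & forall n, expR (t * w n) <= C * n.+1%:R.
Proof.
(* The fourth power of [s y <= expR (s y)] bounds [y^4] by [expR ((1 - t) y) / s^4], whence the
   constant [M]. *)
move=> /andP[t0 t1] wK; pose s := (1 - t) / 4.
have s0 : 0 < s by rewrite divr_gt0// subr_gt0.
pose M := `|K| / s ^+ 4.
have M0 : 0 <= M by rewrite divr_ge0// exprn_ge0// ltW.
have pow_exp (y : R) : 0 <= y -> y ^+ 4 <= expR (4 * s * y) / s ^+ 4.
  move=> y0; rewrite ler_pdivlMr ?exprn_gt0// -exprMn -mulrA expRM_natl.
  rewrite ler_pXn2r ?nnegrE ?expR_ge0 ?(mulr_ge0 y0 (ltW s0))// mulrC.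
  by rewrite (le_trans _ (expR_ge1Dx _))// lerDr.
have step n : expR (t * w n.+1) - expR (t * w n) <= M.
  pose d := w n.+1 - w n.
  have [d0|d0] := leP 0 d; last first.
    rewrite (le_trans _ M0)// subr_le0 ler_expR ler_wpM2l ?(ltW t0)//.
    by rewrite -subr_le0 ltW.
  have e0 := expR_gt0 (t * w n.+1).
  have -> : expR (t * w n) = expR (t * w n.+1) * expR (- (t * d)).
    by rewrite -expRD; congr expR; rewrite /d; ring.
  have e1 := expR_ge1Dx (- (t * d)).
  apply: (@le_trans _ _ (d * expR (t * w n.+1))).
    have td : t * d <= d by nra.
    by nra.
  have -> : expR (t * w n.+1) = expR (w n.+1) * expR (- (4 * s * w n.+1)).
    by rewrite -expRD; congr expR; rewrite /s; field.
  rewrite mulrA expRN ler_pdivrMr ?expR_gt0// (le_trans (wK n))//.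
  apply: (@le_trans _ _ (`|K| * w n.+1 ^+ 4)).
    by rewrite ler_wpM2r ?exprn_ge0// ler_norm.
  by rewrite /M [leRHS]mulrAC -[leRHS]mulrA ler_wpM2l// pow_exp.
exists (expR (t * w 0%N) + M); first by rewrite ltr_wpDr// expR_gt0.
elim=> [|n IHn]; first by rewrite mulr1 lerDl.
rewrite -natr1 mulrDr mulr1 -[leLHS](subrK (expR (t * w n))) addrC.
by apply: lerD => //; rewrite (le_trans (step n))// lerDr expR_ge0.
Qed.

End logarithmic_growth.

Lemma cvg_div_ln (R : realType) (w : nat -> R) :
  (exists2 k, 0 < k & forall n, k * n%:R <= expR (w n)) ->
  (forall t, 0 < t < 1 ->
     exists2 C, 0 < C & forall n, expR (t * w n) <= C * n.+1%:R) ->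
  (fun n => w n / ln n%:R) @ \oo --> (1 : R).
Proof.
move=> [k k0 wk] wC; apply/cvgrPdist_le => e e0.
(* The choice [t = 1 / (1 + e / 2)] costs half of [e]; the other half absorbs the constant
   [ln (C * 2)], whose factor 2 comes from [n + 1 <= 2 n]. *)
have e2 : 0 < 1 + e / 2 by lra.
have [|C C0 {}wC] := wC (1 + e / 2)^-1.
  by rewrite invr_gt0 e2 invf_lt1//=; lra.
near=> n.
have n1 : 1 < n%:R :> R by near: n; exact: nbhs_infty_gtr.
have n0 : 0 < n%:R :> R by lra.
have L0 : 0 < ln (n%:R : R) by rewrite ln_gt0.
have ln_ge (A : R) : expR A <= n%:R -> A <= ln n%:R.
  by move=> An; rewrite -ler_expR lnK.
have Lk : - ln k / e <= ln n%:R.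
  by apply: ln_ge; near: n; exact: nbhs_infty_ger.
have LC : ln (C * 2) * (1 + e / 2) / (e / 2) <= ln n%:R.
  by apply: ln_ge; near: n; exact: nbhs_infty_ger.
rewrite ler_pdivrMr// in Lk; rewrite ler_pdivrMr ?divr_gt0// in LC.
have wl : ln k + ln n%:R <= w n.
  by rewrite -lnM// -ler_expR lnK ?posrE ?mulr_gt0.
have wu : w n <= (ln (C * 2) + ln n%:R) * (1 + e / 2).
  rewrite -ler_pdivrMr// mulrC -lnM ?posrE ?mulr_gt0//.
  rewrite -ler_expR lnK ?posrE ?mulr_gt0//.
  rewrite (le_trans (wC n))// -mulrA ler_pM2l// -natr1; lra.
have -> : 1 - w n / ln n%:R = (ln n%:R - w n) / ln n%:R.
  by field; exact: lt0r_neq0.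
rewrite normrM normfV (gtr0_norm L0) ler_pdivrMr// ler_norml.
by apply/andP; split; nra.
Unshelve. all: by end_near. Qed.

(** * The flat exponential: shape, derivative and increments of [w] *)

Section flat_exponential.
Variables (R : realType) (beta : R) (r : nat).
Hypotheses (beta_gt0 : 0 < beta) (r_gt0 : (0 < r)%N) (r_even : ~~ odd r).

Local Notation f := (flat_exp beta r).
Local Notation w := (fun x : R => 2 * beta * x ^- r).

Lemma flat_exp0 : f 0 = 0%E.
Proof. by rewrite /flat_exp eqxx. Qed.

Lemma flat_expN (x : R) : f (- x) = f x.
Proof.
rewrite /flat_exp oppr_eq0 exprNn -signr_odd (negbTE r_even) expr0 mul1r.
by rewrite lerN2 lerNl andbC.
Qed.

Lemma flat_exp_nondecreasing (x y : R) : 0 <= x -> x <= y -> (f x <= f y)%E.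
Proof.
(* The point 0 is treated apart: there the inverse power has the default value 0, and the
   exponential formula would give 1. *)
rewrite le_eqVlt => /predU1P[<- y0|x0 xy].
  rewrite flat_exp0 /flat_exp; case: ifP => // _.
  by case: ifP => _; rewrite ?leey// lee_fin expR_ge0.
have y0 := lt_le_trans x0 xy.
rewrite /flat_exp !gt_eqF//.
case: (boolP (_ <= y <= _)) => [/andP[_ yB]|_]; last by rewrite leey.
rewrite (le_trans xy yB) (@le_trans _ _ 0) ?(ltW x0)//; last first.
  by rewrite oppr_le0 powR_ge0.
rewrite lee_fin ler_expR !mulNr lerN2 ler_pM2l// lef_pV2 ?posrE ?exprn_gt0//.
by rewrite ler_pXn2r ?nnegrE ?(ltW x0) ?(ltW y0).
Qed.

(** Finiteness excludes the branch [+oo], so [delta] never has to be compared with [flat_bound]. *)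
Lemma flat_exp_near (x : R) : 0 < x -> (\forall z \near x, f z \is a fin_num) ->
  \forall z \near x, expR (- beta * z ^- r) = fine (f z).
Proof.
move=> x0 fx; near=> z.
have z0 : 0 < z by near: z; exact: lt_nbhsr.
have : f z \is a fin_num by near: z.
by rewrite /flat_exp gt_eqF//; case: ifP.
Unshelve. all: by end_near. Qed.

Lemma derive_flat_exp (x : R) : 0 < x -> (\forall z \near x, f z \is a fin_num) ->
  'D_1 (fine \o f) x =
  expR (- beta * x ^- r) * (beta * r%:R * x ^- r.+1).
Proof.
move=> x0 fx; rewrite -(near_eq_derive _ (flat_exp_near x x0 fx)).
have xr0 : x ^+ r != 0 by rewrite expf_neq0// gt_eqF.
have dV : is_derive x 1 (fun z : R => (z ^+ r)^-1)
    (- (x ^+ r) ^- 2 *: (r%:R * x ^+ r.-1)).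
  apply: is_deriveV => //.
  have := is_deriveX r (is_derive_id x (1 : R)).
  by rewrite exprfctE /GRing.scale /= mulr1.
have dN : is_derive x 1 (fun z : R => - beta * z ^- r)
    (- beta * (- (x ^+ r) ^- 2 *: (r%:R * x ^+ r.-1))).
  exact: (is_deriveZ (- beta) dV).
rewrite (derive_val (is_derive := is_derive1_comp (is_derive_expR _) dN)).
rewrite /GRing.scale /=; congr (_ * _).
case: r r_gt0 xr0 => // n _ /= xn0.
by rewrite !exprS; field; rewrite expf_neq0 gt_eqF.
Qed.

(** Meant for consecutive iterates [v], [a] and the starting point [M]. The difference [a^-r - v^-r]
    lies between [r (v - a) M^-(r+1)] and [r (v - a) a^-(r+1)], and the equation turns
    [(v - a) expR (w a)] into [beta r a^-(r+1)]. *)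
Lemma flat_increment (M a v : R) : 0 < a -> a <= v -> v <= M ->
  v - a = beta * r%:R * a ^- r.+1 * expR (- w a) ->
  2 * (beta * r%:R) ^+ 2 * M ^- (2 * r.+1) <= (w a - w v) * expR (w a) /\
  (w a - w v) * expR (w a) <=
    2 * (beta * r%:R) ^+ 2 * M ^+ (2 * r.-1) / (2 * beta) ^+ 4 * w a ^+ 4.
Proof.
(* Since [r >= 1], the fourth power of [a^-r] contains [a^-(2r+2)]; the surplus [a^-(2r-2)] is
   compensated by the power of [M >= a]. *)
have re : (r * 4 = 2 * r.-1 + (r.+1 + r.+1))%N by lia.
move=> a0 av vM va.
have v0 := lt_le_trans a0 av; have M0 := lt_le_trans v0 vM.
rewrite expRN in va; rewrite -!exprVn in va *.
rewrite [(2 * beta)^-1 ^+ 4]exprVn.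
set E := expR _ in va *.
have E0 : 0 < E by exact: expR_gt0.
have {}va : (v - a) * E = beta * r%:R * a^-1 ^+ r.+1.
  by rewrite va -mulrA mulVf ?mulr1 ?gt_eqF.
have A0 : 0 < a^-1 by rewrite invr_gt0.
have V0 : 0 < v^-1 by rewrite invr_gt0.
have m0 : 0 < M^-1 by rewrite invr_gt0.
have VA : v^-1 <= a^-1 by rewrite lef_pV2.
have mV : M^-1 <= v^-1 by rewrite lef_pV2.
have br0 : 0 < beta * r%:R by rewrite mulr_gt0// ltr0n.
have h0 : 0 <= v - a by rewrite subr_ge0.
(* Bernoulli's inequality for the ratio [a / v], and then for [v / a], replaces the mean value
   theorem. *)
have diff_le : a^-1 ^+ r - v^-1 ^+ r <= r%:R * (v - a) * a^-1 ^+ r.+1.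
  have bern : 1 + r%:R * (a / v - 1) <= (1 + (a / v - 1)) ^+ r.
    by apply: bernoulli_ineq; rewrite lerBrDr addNr divr_ge0 ?ltW.
  rewrite [1 + (_ - 1)]addrC subrK in bern.
  have {}bern : 1 - r%:R * ((v - a) / a) <= (a / v) ^+ r.
    rewrite (le_trans _ bern)// lerD2l -mulrN ler_wpM2l//.
    have -> : a / v - 1 = - ((v - a) / v).
      by rewrite mulrBl divff ?gt_eqF// opprB.
    by rewrite lerN2 ler_wpM2l.
  rewrite -(ler_pM2l (exprn_gt0 r A0)) -exprMn mulKf ?gt_eqF// in bern.
  by rewrite exprS; lra.
have diff_ge : r%:R * (v - a) * M^-1 ^+ r.+1 <= a^-1 ^+ r - v^-1 ^+ r.
  have bern : 1 + r%:R * (v / a - 1) <= (1 + (v / a - 1)) ^+ r.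
    by apply: bernoulli_ineq; rewrite lerBrDr addNr divr_ge0 ?ltW.
  rewrite [1 + (_ - 1)]addrC subrK in bern.
  rewrite -(ler_pM2l (exprn_gt0 r V0)) -exprMn mulKf ?gt_eqF// in bern.
  rewrite mulrDr mulr1 in bern; rewrite lerBrDl (le_trans _ bern)// lerD2l.
  have -> : v / a - 1 = (v - a) / a by rewrite mulrBl divff// gt_eqF.
  rewrite mulrCA -[leLHS]mulrA ler_wpM2l// mulrCA ler_wpM2l// exprSr.
  rewrite ler_pM ?exprn_ge0 ?(ltW m0) ?(le_trans mV)//.
  by rewrite ler_pXn2r ?nnegrE ?(ltW m0) ?(ltW V0).
have -> : 2 * beta * a^-1 ^+ r - 2 * beta * v^-1 ^+ r =
    2 * beta * (a^-1 ^+ r - v^-1 ^+ r) by rewrite mulrBr.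
have b2 : 0 <= 2 * beta by rewrite mulr_ge0 ?(ltW beta_gt0).
split.
- apply: le_trans (ler_wpM2r (ltW E0) (ler_wpM2l b2 diff_ge)).
  have -> : 2 * beta * (r%:R * (v - a) * M^-1 ^+ r.+1) * E =
      2 * beta * r%:R * M^-1 ^+ r.+1 * ((v - a) * E) by ring.
  rewrite va mul2n -addnn exprD.
  have -> : 2 * (beta * r%:R) ^+ 2 * (M^-1 ^+ r.+1 * M^-1 ^+ r.+1) =
      2 * beta * r%:R * M^-1 ^+ r.+1 * (beta * r%:R * M^-1 ^+ r.+1) by ring.
  rewrite ler_wpM2l ?mulr_ge0 ?exprn_ge0 ?(ltW m0)//; first exact: ltW.
  rewrite ler_wpM2l ?(ltW br0)// ler_pXn2r ?nnegrE ?(ltW m0) ?(ltW A0)//.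
  exact: le_trans mV VA.
- apply: le_trans (ler_wpM2r (ltW E0) (ler_wpM2l b2 diff_le)) _.
  have -> : 2 * beta * (r%:R * (v - a) * a^-1 ^+ r.+1) * E =
      2 * beta * r%:R * a^-1 ^+ r.+1 * ((v - a) * E) by ring.
  rewrite va [(2 * beta * _) ^+ 4]exprMn.
  set B := (2 * beta) ^+ 4.
  have -> : 2 * (beta * r%:R) ^+ 2 * M ^+ (2 * r.-1) / B *
      (B * (a^-1 ^+ r) ^+ 4) =
      2 * (beta * r%:R) ^+ 2 * (M ^+ (2 * r.-1) * (a^-1 ^+ r) ^+ 4).
    by field; rewrite expf_neq0// mulf_neq0// gt_eqF.
  have -> : 2 * beta * r%:R * a^-1 ^+ r.+1 * (beta * r%:R * a^-1 ^+ r.+1) =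
      2 * (beta * r%:R) ^+ 2 * a^-1 ^+ (r.+1 + r.+1) by rewrite exprD; ring.
  have c0 : 0 <= 2 * (beta * r%:R) ^+ 2 by rewrite mulr_ge0// sqr_ge0.
  apply: (ler_wpM2l c0).
  have -> : (a^-1 ^+ r) ^+ 4 = a^-1 ^+ (2 * r.-1) * a^-1 ^+ (r.+1 + r.+1).
    by rewrite -exprM -exprD re.
  rewrite mulrA -exprMn ler_peMl ?exprn_ge0 ?(ltW A0)// exprn_ege1//.
  by rewrite ler_pdivlMr// mul1r (le_trans av).
Qed.

End flat_exponential.

(** * Comparison with the harmonic series, and continuity of powers at 1 *)

Lemma nneseries_even_harmonic (R : realType) (t : nat -> R) (c : R) :
  0 < c -> (forall n, 0 <= t n) ->
  (forall n, c / n.+1%:R <= t (2 * n)%N) ->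
  (\sum_(0 <= n <oo) (t n)%:E)%E = +oo%E.
Proof.
move=> c0 t0 ct; apply: eq_infty => A.
have dvg : series (@harmonic R) @ \oo --> +oo.
  apply: nondecreasing_dvgn_lt; last exact: dvg_harmonic.
  by apply: nondecreasing_series => n _ _; exact: harmonic_ge0.
have [k _ /(_ k (leqnn k)) /= Ak] := (cvgryPge _).1 dvg (A / c).
(* The first [2 k] terms include [k] of even index, which dominate [c] times the [k]-th harmonic
   partial sum. *)
apply: le_trans (nneseries_lim_ge (2 * k) _); last by move=> n _ _; rewrite lee_fin.
rewrite sumEFin lee_fin; rewrite ler_pdivrMr// in Ak.
rewrite (le_trans Ak)//.
elim: k {Ak} => [|k IHk]; first by rewrite muln0 /series /= !big_geq// mul0r.
rewrite mulnS add2n /series /= !big_nat_recr//= mulrDl -addrA lerD//.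
by rewrite ler_wpDr// mulrC.
Qed.

Lemma powR_cvg1 (R : realType) (p : R) : x `^ p @[x --> (1 : R)] --> (1 : R).
Proof.
have d1 : derivable (fun x : R => x `^ p) 1 1.
  by apply: derivable_powR; rewrite in_itv/= ltr01.
have : {for 1, continuous (fun x : R => x `^ p)}.
  exact/differentiable_continuous/derivable1_diffP.
by rewrite /prop_for /continuous_at powR1.
Qed.

(** * Asymptotics of the alternating projections *)

Theorem mainTheorem3 (R : realType) (beta : R) (hbeta : 0 < beta)
  (r : nat) (hr0 : (0 < r)%N) (hr : ~~ odd r)
  (delta : R) (hdelta : 0 < delta)
  (hdiff : forall t : R, 0 <= t <= delta -> ediff (flat_exp beta r) t)
  (u0 : R) (hu0 : 0 < u0 < delta)
  (x : nat -> R * R) (hx0 : x 0%N = (u0, 0))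
  (hxC : forall n : nat,
     x (2 * n + 1)%N = metric_proj (epigraph (flat_exp beta r)) (x (2 * n)%N))
  (hxL : forall n : nat,
     x (2 * n + 2)%N = metric_proj (@xaxis R) (x (2 * n + 1)%N))
  (u : nat -> R) (hu : forall n : nat, x (2 * n)%N = (u n, 0)) :
  ((fun n : nat => u n / ((2 * beta / ln n%:R) `^ r%:R^-1)) @ \oo --> (1 : R))
  /\
  (forall gamma : R, 0 < gamma < 2 ->
     (\sum_(0 <= n <oo) (enorm (x n.+1 - x n) `^ gamma)%R%:E)%E = +oo%E).
Proof.
have proj v : 0 < v < delta -> exists a, [/\ 0 < a <= v,
    v - a = beta * r%:R * a ^- r.+1 * expR (- (2 * beta * a ^- r)) &
    metric_proj (epigraph (flat_exp beta r)) (v, 0) =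
      (a, expR (- beta * a ^- r))].
  move=> vd; have [a [a_itv + projE]] := metric_proj_epigraph R _ delta v
    (flat_exp0 R beta r) (flat_expN R beta r hr)
    (flat_exp_nondecreasing R beta r hbeta hr0) hdiff vd.
  have [a0 av] := andP a_itv; have [v0 vd'] := andP vd.
  have [|fin_a _] := hdiff a; first by rewrite !ltW// (le_lt_trans av).
  have Fa := nbhs_singleton (flat_exp_near R beta r a a0 fin_a).
  rewrite derive_flat_exp// /= -Fa => va.
  exists a; split => //; last by rewrite projE Fa.
  by rewrite va mulrA -expRD mulrC; congr (_ * expR _); ring.
(* Conditional at first: that all iterates stay in []0, u0]] is proved by induction from this very
   step. *)
have step n : 0 < u n < delta -> [/\ 0 < u n.+1 <= u n,
    u n - u n.+1 = beta * r%:R * u n.+1 ^- r.+1 *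
      expR (- (2 * beta * u n.+1 ^- r)) &
    x (2 * n + 1)%N = (u n.+1, expR (- beta * u n.+1 ^- r))].
  move=> /proj [a [a_itv va]]; rewrite -hu -hxC => xa.
  have := hxL n; rewrite metric_proj_xaxis xa /=.
  by rewrite addnC -mulnS hu => -[->].
have u_itv n : 0 < u n <= u0.
  have [u0_gt0 u0d] := andP hu0.
  elim: n => [|n /andP[un0 un]].
    by have := hu 0%N; rewrite muln0 hx0 => -[<-]; rewrite u0_gt0 lexx.
  have [|/andP[un1 un1_le] _ _] := step n; first by rewrite un0 (le_lt_trans un).
  by rewrite un1 (le_trans un1_le).
have {}step n : [/\ 0 < u n.+1 <= u n,
    u n - u n.+1 = beta * r%:R * u n.+1 ^- r.+1 *
      expR (- (2 * beta * u n.+1 ^- r)) &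
    x (2 * n + 1)%N = (u n.+1, expR (- beta * u n.+1 ^- r))].
  apply: step; have /andP[-> un] := u_itv n.
  by case/andP: hu0 => _; exact: le_lt_trans.
have u0_gt0 : 0 < u0 by case/andP: hu0.
pose w n := 2 * beta * u n ^- r.
have w_gt0 n : 0 < w n.
  by rewrite !mulr_gt0// invr_gt0 exprn_gt0//; case/andP: (u_itv n).
have w_ge0 n : 0 <= w n by exact: ltW.
have w_step n :
    2 * (beta * r%:R) ^+ 2 * u0 ^- (2 * r.+1) <= (w n.+1 - w n) * expR (w n.+1) /\
    (w n.+1 - w n) * expR (w n.+1) <=
      2 * (beta * r%:R) ^+ 2 * u0 ^+ (2 * r.-1) / (2 * beta) ^+ 4 * w n.+1 ^+ 4.
  have [/andP[un1 un1_le] un _] := step n.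
  by apply: flat_increment => //; case/andP: (u_itv n).
have w_lower : exists2 k, 0 < k & forall n, k * n%:R <= expR (w n).
  apply: expR_growth_lower (fun n => (w_step n).1) => //.
  by rewrite mulr_gt0 ?invr_gt0 ?exprn_gt0 ?mulr_gt0 ?ltr0n.
have w_upper t : 0 < t < 1 ->
    exists2 C, 0 < C & forall n, expR (t * w n) <= C * n.+1%:R.
  by move=> t01; apply: expR_growth_upper t01 (fun n => (w_step n).2).
split.
- have cvg_inv : (fun n => (w n / ln n%:R)^-1) @ \oo --> (1 : R).
    rewrite -[X in _ --> X]invr1.
    by apply: cvgV; [exact: oner_neq0 | exact: cvg_div_ln].
  have := cvg_comp _ _ cvg_inv (powR_cvg1 R r%:R^-1).
  apply: cvg_trans; apply: near_eq_cvg; near=> n.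
  have L0 : 0 < ln (n%:R : R) by rewrite ln_gt0//; near: n; exact: nbhs_infty_gtr.
  have [un0 _] := andP (u_itv n).
  have b2 : 0 < 2 * beta by rewrite mulr_gt0.
  (* By definition of [w], [2 beta / w n] is the [r]-th power of [u n]; the second factor is the one
     that tends to 1. *)
  have uE : u n = (2 * beta / ln n%:R) `^ r%:R^-1 * (w n / ln n%:R)^-1 `^ r%:R^-1.
    have wL0 : 0 < w n / ln n%:R by exact: divr_gt0 (w_gt0 n) L0.
    rewrite -powRM ?invr_ge0 ?(ltW wL0)//; last by rewrite ltW ?divr_gt0.
    have -> : 2 * beta / ln n%:R * (w n / ln n%:R)^-1 = u n ^+ r.
      by rewrite /w; field; rewrite !gt_eqF// exprn_gt0.
    rewrite -powR_mulrn ?(ltW un0)// -powRrM mulfV ?powRr1 ?(ltW un0)//.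
    by rewrite pnatr_eq0 -lt0n.
  by rewrite [in RHS]uE [RHS]mulrC mulKf// powR_eq0 gt_eqF// divr_gt0.
- move=> gamma /andP[g0 g2].
  have [|C C0 wC] := w_upper (gamma / 2); first by apply/andP; split; lra.
  (* The bound is used at index [n + 1], and [n + 2 <= 2 (n + 1)] accounts for the factor 2. *)
  apply: (@nneseries_even_harmonic _ _ (C * 2)^-1).
    by rewrite invr_gt0 mulr_gt0.
    by move=> n; exact: powR_ge0.
  move=> n; have [_ _ xn] := step n; have un0 := u_itv n.+1.
  (* Even-indexed points lie on the axis, so the vertical part of the step towards the epigraph is
     the value of [f] at [u n.+1]. *)
  have enorm_ge (p : R * R) : p.2 <= enorm p.
    rewrite /enorm (le_trans (ler_norm _))// -sqrtr_sqr.
    rewrite ler_sqrt ?addr_ge0 ?sqr_ge0//.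
    by rewrite lerDr sqr_ge0.
  rewrite -[(2 * n).+1]addn1 xn hu.
  apply: (@le_trans _ _ (expR (- beta * u n.+1 ^- r) `^ gamma)); last first.
    apply: ge0_ler_powR; rewrite ?nnegrE ?expR_ge0 ?sqrtr_ge0 ?(ltW g0)//.
    by rewrite (le_trans _ (enorm_ge _))//= subr0.
  rewrite -expRM.
  have -> : - beta * u n.+1 ^- r * gamma = - (gamma / 2 * w n.+1).
    by rewrite /w; field; rewrite expf_neq0// gt_eqF//; case/andP: un0.
  rewrite expRN -invfM lef_pV2 ?posrE ?expR_gt0 ?mulr_gt0//.
  rewrite (le_trans (wC _))// -mulrA ler_pM2l//.
  by rewrite -natrM ler_nat mulSn mul1n addSnnS leq_addl.
Unshelve. all: by end_near. Qed.
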